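(* Let $m\ge2$ and $0<q<1$. The operator $A_q=\{\mathcal D_q,\mathcal Z\}$ is not a scalar multiple of the identity on $\mathscr P_{2,0}^0$, and $B_q=\{\mathcal D_q^\dagger,\mathcal Z^\dagger\}$ is not a scalar multiple of the identity on $\mathscr P_{0,2}^m$. In particular, $A_q$ cannot be expressed as a function only of the total $z$-degree and the total spinor number, and $B_q$ cannot be expressed as a function only of the total $w$-degree and the total spinor number.
   Context: $\{X,Y\}=XY+YX$. $\mathscr P_m=\mathbb C[z_1,\dots,z_m,w_1,\dots,w_m]\otimes\bigwedge\mathbb C^m$; $\mathscr P_{r,s}^n$ is the subspace of polynomials homogeneous of degree $r$ in $z$ and $s$ in $w$ with values in $\bigwedge^n\mathbb C^m$; $n$ is the total spinor number. $D_{q,x}f=\frac{f(\dots,qx,\dots)-f(\dots,x,\dots)}{(q-1)x}$; $\varepsilon_i$ is exterior multiplication by the $i$-th basis vector, $\iota_i=\varepsilon_i^*$ contraction. $\mathcal D_q=\sum_i\varepsilon_iD_{q,z_i}$, $\mathcal D_q^\dagger=\sum_i\iota_iD_{q,w_i}$, $\mathcal Z=\sum_i\iota_iz_i$, $\mathcal Z^\dagger=\sum_i\varepsilon_iw_i$ (coordinates acting by multiplication). *)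

(* Defs.v *)
From HB Require Import structures.
From mathcomp Require Import all_boot all_order all_algebra.
From mathcomp Require Import complex mpoly.
From mathcomp Require Import reals.

Set Implicit Arguments.
Unset Strict Implicit.
Unset Printing Implicit Defensive.

Import Order.TTheory GRing.Theory Num.Theory.

Local Open Scope ring_scope.

Section QDerivative.
Variables (C : fieldType) (k : nat) (q : C) (i : 'I_k).
Implicit Types f p : {mpoly C[k]}.

(* f(.., q x_i, ..) *)
Definition qdilate f : {mpoly C[k]} :=
  f \mPo [tuple (if j == i then q *: 'X_j else 'X_j) | j < k].

(* The quotient p / x_i, for p divisible by x_i; on other polynomials the
   value is meaningless, since U_(i) is truncated off the exponents. *)
Definition divX p : {mpoly C[k]} := \sum_(a <- msupp p) p@_a *: 'X_[a - U_(i)].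

Definition qderiv f : {mpoly C[k]} := (q - 1)^-1 *: divX (qdilate f - f).

Lemma qdilate_coef f a : (qdilate f)@_a = q ^+ a i * f@_a.
Proof.
rewrite /qdilate comp_mpolyE raddf_sum /=.
under eq_bigr => b _.
  have -> : \prod_(j < k) tnth [tuple (if j == i then q *: 'X_j else 'X_j)
      | j < k] j ^+ b j = q ^+ b i *: 'X_[b] :> {mpoly C[k]}.
    rewrite mpolyXE_id (bigD1 i) //= tnth_mktuple eqxx exprZn.
    rewrite [in RHS](bigD1 i) //= -scalerAl; congr (_ *: (_ * _)).
    by apply: eq_bigr => j /negbTE ji; rewrite tnth_mktuple ji.
  rewrite !mcoeffZ mcoeffX; over.
have [fa|fa] := boolP (a \in msupp f).
  rewrite (bigD1_seq a) ?msupp_uniq //= eqxx mulr1 mulrC big1 ?addr0 // => b.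
  by move=> /negbTE ba; rewrite ba !mulr0.
rewrite (memN_msupp_eq0 fa) mulr0 big_seq big1 // => b fb.
by case: eqP => [ba|_]; rewrite ?mulr0 //; rewrite -ba fb in fa.
Qed.

Lemma divXK p : (forall a, a \in msupp p -> (0 < a i)%N) -> 'X_i * divX p = p.
Proof.
move=> p_i; rewrite [RHS]mpolyE mulr_sumr big_seq [RHS]big_seq.
apply: eq_bigr => a /p_i a_i; rewrite -scalerAr -mpolyXD addmC submK //.
by rewrite lep1mP -lt0n.
Qed.

(* The division in the definition of qderiv is exact. *)
Lemma qderivE f : q != 1 ->
  ((q - 1) *: 'X_i) * qderiv f = qdilate f - f.
Proof.
move=> q1; rewrite -scalerAl -scalerAr scalerA divff ?subr_eq0 // scale1r.
apply: divXK => a; rewrite mcoeff_msupp mcoeffB qdilate_coef lt0n.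
by apply: contra => /eqP->; rewrite expr0 mul1r subrr.
Qed.

End QDerivative.

(* The variables of {mpoly C[m + m]} are z_1, .., z_m followed by
   w_1, .., w_m. *)
Notation zvar i := (lshift _ i).
Notation wvar i := (rshift _ i).

Section Degrees.
Variable m : nat.
Implicit Types a b : 'X_{1..m + m}.

Definition zdeg a : nat := \sum_(i < m) a (zvar i).
Definition wdeg a : nat := \sum_(i < m) a (wvar i).

Fact zdeg0 : zdeg 0%MM = 0%N.
Proof. by rewrite /zdeg big1 // => i _; rewrite mnm0E. Qed.

Fact zdegD : {morph zdeg : a b / (a + b)%MM >-> (a + b)%N}.
Proof.
by move=> a b; rewrite /zdeg -big_split; apply: eq_bigr => i _; rewrite mnmDE.
Qed.

Fact wdeg0 : wdeg 0%MM = 0%N.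
Proof. by rewrite /wdeg big1 // => i _; rewrite mnm0E. Qed.

Fact wdegD : {morph wdeg : a b / (a + b)%MM >-> (a + b)%N}.
Proof.
by move=> a b; rewrite /wdeg -big_split; apply: eq_bigr => i _; rewrite mnmDE.
Qed.

HB.instance Definition _ := isMeasure.Build (m + m) zdeg zdeg0 zdegD.
HB.instance Definition _ := isMeasure.Build (m + m) wdeg wdeg0 wdegD.

End Degrees.

(* C[z, w] (x) /\ C^m: f stands for \sum_S f S (x) e_S, where
   e_S = e_{s_1} /\ .. /\ e_{s_n} for S = {s_1 < .. < s_n}. *)
Notation spinpoly C m := {ffun {set 'I_m} -> {mpoly C[m + m]}}.

Section Spinors.
Variables (C : numClosedFieldType) (m : nat).
Implicit Types (f : spinpoly C m) (S T : {set 'I_m}).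

(* The coefficient of e_S in e_i /\ e_T. *)
Definition wedge_coef (i : 'I_m) S T : C :=
  if (i \notin T) && (S == i |: T)
  then (-1) ^+ #|[set j in T | (j < i)%N]| else 0.

Definition eps (i : 'I_m) f : spinpoly C m :=
  [ffun S => \sum_T wedge_coef i S T *: f T].

(* The adjoint of eps i, for the Hermitian structure of /\ C^m in which the
   e_S are orthonormal. *)
Definition iota_ (i : 'I_m) f : spinpoly C m :=
  [ffun S => \sum_T (wedge_coef i T S)^* *: f T].

Definition coefwise (F : {mpoly C[m + m]} -> {mpoly C[m + m]}) f :
  spinpoly C m := [ffun S => F (f S)].

Definition Dq (q : C) f : spinpoly C m :=
  \sum_(i < m) eps i (coefwise (qderiv q (zvar i)) f).

Definition Dqdag (q : C) f : spinpoly C m :=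
  \sum_(i < m) iota_ i (coefwise (qderiv q (wvar i)) f).

Definition Zop f : spinpoly C m :=
  \sum_(i < m) iota_ i (coefwise ( *%R 'X_(zvar i)) f).

Definition Zdag f : spinpoly C m :=
  \sum_(i < m) eps i (coefwise ( *%R 'X_(wvar i)) f).

(* P_{r,s}^n: degree r in z, degree s in w, values in /\^n C^m. *)
Definition component (r s n : nat) : {pred spinpoly C m} :=
  [pred f : spinpoly C m | [forall S : {set 'I_m}, if #|S| == n
     then (f S \is r.-homog for (@zdeg m)) && (f S \is s.-homog for (@wdeg m))
     else f S == 0]].

Definition anticomm (X Y : spinpoly C m -> spinpoly C m) f : spinpoly C m :=
  X (Y f) + Y (X f).

Definition Aop (q : C) := anticomm (Dq q) Zop.
Definition Bop (q : C) := anticomm (Dqdag q) Zdag.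

Definition scalar_on (W : {pred spinpoly C m})
    (X : spinpoly C m -> spinpoly C m) : Prop :=
  exists c : C, forall f, f \in W -> X f = c *: f.

(* A function phi of the z-degree and the spinor number is the operator acting
   on each P_{r,s}^n as the scalar phi r n; likewise for the w-degree. *)
Definition fun_of_zdeg_spinor (X : spinpoly C m -> spinpoly C m) : Prop :=
  exists phi : nat -> nat -> C,
    forall r s n f, f \in component r s n -> X f = phi r n *: f.

Definition fun_of_wdeg_spinor (X : spinpoly C m -> spinpoly C m) : Prop :=
  exists phi : nat -> nat -> C,
    forall r s n f, f \in component r s n -> X f = phi s n *: f.

End Spinors.

(* Main.v *)
(** On a 0-form or on a top-degree form one of the two terms of the
    anticommutator vanishes, and what remains is the q-Euler operator
    [\sum_i x_i D_(q, x_i)], which multiplies the monomial [x^a] by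
    [\sum_i (q^(a_i) - 1) / (q - 1)].  The eigenvalue is [q + 1] on [x_i^2] and
    [2] on [x_i x_j], and these differ for [q != 1]. *)

Require Import Defs.
From mathcomp Require Import all_boot all_order all_algebra.
From mathcomp Require Import complex mpoly.
From mathcomp Require Import reals.

Import GRing.Theory Num.Theory.

Local Open Scope ring_scope.
Local Open Scope complex_scope.

Set Implicit Arguments.
Unset Strict Implicit.
Unset Printing Implicit Defensive.

(** * The q-Euler operator on monomials *)

Section QEuler.
Variables (C : fieldType) (k : nat) (q : C).

Lemma qderiv0 (i : 'I_k) : qderiv q i 0 = 0.
Proof.
by rewrite /qderiv /qdilate comp_mpoly0 subrr /divX msupp0 big_nil scaler0.
Qed.

Lemma qdilateX (i : 'I_k) (a : 'X_{1..k}) :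
  qdilate q i 'X_[a] = q ^+ a i *: 'X_[a].
Proof.
apply/mpolyP => b; rewrite qdilate_coef mcoeffZ mcoeffX.
by case: eqP => [->|_] //; rewrite !mulr0.
Qed.

(** After multiplication by [q - 1] this is the exactness identity [qderivE], so the truncated
    quotient [divX] never has to be computed. *)
Lemma mulX_qderivX (i : 'I_k) (a : 'X_{1..k}) : q != 1 ->
  'X_i * qderiv q i 'X_[a] = ((q ^+ a i - 1) / (q - 1)) *: 'X_[a].
Proof.
move=> q1; have q1' : q - 1 != 0 by rewrite subr_eq0.
apply: (scalerI q1'); rewrite scalerAl qderivE // qdilateX scalerA.
by rewrite mulrC divfK // scalerBl scale1r.
Qed.

(** The map [v] selects the variables involved, so that one argument serves both the [z] and the [w]
    variables. *)
Definition qeuler (m : nat) (v : 'I_m -> 'I_k) (p : {mpoly C[k]}) :=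
  \sum_(i < m) 'X_(v i) * qderiv q (v i) p.

Lemma qeulerX (m : nat) (v : 'I_m -> 'I_k) (a : 'X_{1..k}) : q != 1 ->
  qeuler v 'X_[a] = (\sum_(i < m) (q ^+ a (v i) - 1) / (q - 1)) *: 'X_[a].
Proof.
by move=> q1; rewrite scaler_suml; apply: eq_bigr => i _; rewrite mulX_qderivX.
Qed.

Lemma qeuler_not_scalar (m : nat) (v : 'I_m -> 'I_k) (i j : 'I_m) (c : C) :
    q != 1 -> injective v -> i != j ->
    qeuler v 'X_[U_(v i) + U_(v i)] = c *: 'X_[U_(v i) + U_(v i)] ->
  qeuler v 'X_[U_(v i) + U_(v j)] != c *: 'X_[U_(v i) + U_(v j)].
Proof.
move=> q1 v_inj ij; have q1' : q - 1 != 0 by rewrite subr_eq0.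
(* Comparing coefficients at the monomial itself turns an eigenvector equation into an equality of
   scalars. *)
have eigen a d : d *: 'X_[a] = c *: 'X_[a] :> {mpoly C[k]} -> d = c.
  by move/(congr1 (mcoeff a)); rewrite !mcoeffZ mcoeffX eqxx !mulr1.
rewrite !qeulerX // => /eigen ci; apply/eqP => /eigen; rewrite -ci.
rewrite (bigD1 i) //= [in RHS](bigD1 i) //= [in RHS]big1 => [|l li]; last first.
  by rewrite mnmDE !mnm1E !(inj_eq v_inj) eq_sym (negbTE li) expr0 subrr mul0r.
rewrite (bigD1 j) 1?eq_sym //= big1 => [|l /andP[li lj]]; last first.
  rewrite mnmDE !mnm1E !(inj_eq v_inj) ![_ == l]eq_sym.
  by rewrite (negbTE li) (negbTE lj) expr0 subrr mul0r.
rewrite !mnmDE !mnm1E !eqxx !(inj_eq v_inj) (negbTE ij) eq_sym (negbTE ij).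
(* The mixed monomial gives [1 + 1], the square gives the geometric sum [1 + q]; cancelling a 1
   leaves [q = 1]. *)
rewrite !addr0 addn0 add0n expr1 divff // -[X in _ ^+ X]/2%N subrX1.
rewrite mulrAC divff // mul1r !big_ord_recr big_ord0 /= add0r expr0 expr1.
by move/addrI/esym/eqP; apply/negP.
Qed.

End QEuler.

(** * The anticommutators on forms of degree 0 and m *)

Section Extremes.
Variables (C : numClosedFieldType) (m : nat) (q : C).
Implicit Types (f : spinpoly C m) (S T : {set 'I_m}) (i : 'I_m).

Lemma wedge_coef_notin i S T : i \notin S -> wedge_coef C i S T = 0.
Proof.
move=> iS; rewrite /wedge_coef; case: ifP => // /andP[_ /eqP ST].
by rewrite ST setU11 in iS.
Qed.

Lemma wedge_coef_in i S T : i \in T -> wedge_coef C i S T = 0.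
Proof. by rewrite /wedge_coef => ->. Qed.

Lemma wedge_coef_neq i S T : T != S :\ i -> wedge_coef C i S T = 0.
Proof.
rewrite /wedge_coef; case: ifP => // /andP[iT /eqP->].
by rewrite setU1K // eqxx.
Qed.

(** The coefficient is a sign. Its square is what remains when [eps i] and [iota_ i] are composed
    along [S] and [S :\ i]. *)
Lemma wedge_coef_norm i S : i \in S ->
  wedge_coef C i S (S :\ i) * (wedge_coef C i S (S :\ i))^* = 1.
Proof.
move=> iS; rewrite /wedge_coef setD11 setD1K // eqxx /=.
by rewrite -normCK normrX normrN1 !expr1n.
Qed.

Definition spin S (p : {mpoly C[m + m]}) : spinpoly C m :=
  [ffun T => if T == S then p else 0].

Lemma DqE f S :
  Dq q f S = \sum_i \sum_T wedge_coef C i S T *: qderiv q (zvar i) (f T).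
Proof.
rewrite sum_ffunE; apply: eq_bigr => i _; rewrite ffunE.
by apply: eq_bigr => T _; rewrite ffunE.
Qed.

Lemma DqdagE f S :
  Dqdag q f S =
    \sum_i \sum_T (wedge_coef C i T S)^* *: qderiv q (wvar i) (f T).
Proof.
rewrite sum_ffunE; apply: eq_bigr => i _; rewrite ffunE.
by apply: eq_bigr => T _; rewrite ffunE.
Qed.

Lemma ZopE f S :
  Zop f S = \sum_i \sum_T (wedge_coef C i T S)^* *: ('X_(zvar i) * f T).
Proof.
rewrite sum_ffunE; apply: eq_bigr => i _; rewrite ffunE.
by apply: eq_bigr => T _; rewrite ffunE.
Qed.

Lemma ZdagE f S :
  Zdag f S = \sum_i \sum_T wedge_coef C i S T *: ('X_(wvar i) * f T).
Proof.
rewrite sum_ffunE; apply: eq_bigr => i _; rewrite ffunE.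
by apply: eq_bigr => T _; rewrite ffunE.
Qed.

Lemma Dq_spin0 (p : {mpoly C[m + m]}) i :
  Dq q (spin set0 p) [set i] =
    wedge_coef C i [set i] set0 *: qderiv q (zvar i) p.
Proof.
rewrite DqE (bigD1 i) //= [X in _ + X]big1 => [|j ji].
  rewrite (bigD1 set0) //= big1 ?addr0 => [|T T0]; first by rewrite ffunE eqxx.
  by rewrite ffunE (negbTE T0) qderiv0 scaler0.
by rewrite big1 // => T _; rewrite wedge_coef_notin ?scale0r ?inE.
Qed.

Lemma Dqdag_spinT (p : {mpoly C[m + m]}) i :
  Dqdag q (spin setT p) (setT :\ i) =
    (wedge_coef C i setT (setT :\ i))^* *: qderiv q (wvar i) p.
Proof.
rewrite DqdagE (bigD1 i) //= [X in _ + X]big1 => [|j ji].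
  rewrite (bigD1 setT) //= big1 ?addr0 => [|T TT]; first by rewrite ffunE eqxx.
  by rewrite ffunE (negbTE TT) qderiv0 scaler0.
by rewrite big1 // => T _; rewrite wedge_coef_in ?conjC0 ?scale0r // !inE ji.
Qed.

Lemma Aop_spin0 (p : {mpoly C[m + m]}) :
  Aop q (spin set0 p) set0 = qeuler q (@lshift m m) p.
Proof.
(* The term [Dq (Zop f)] has no component at [set0], since every basis form produced by [eps i]
   contains [i]. *)
rewrite ffunE DqE big1 ?add0r => [|i _]; last first.
  by rewrite big1 // => T _; rewrite wedge_coef_notin ?inE ?scale0r.
rewrite ZopE; apply: eq_bigr => i _.
(* [iota_ i] reaches the empty form only from [[set i]]. *)
rewrite (bigD1 [set i]) //= big1 ?addr0 => [|T Ti]; last first.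
  have [iT|iT] := boolP (i \in T).
    rewrite wedge_coef_neq ?conjC0 ?scale0r //; apply: contraNneq Ti => T0.
    by rewrite -(setD1K iT) -T0 setU0.
  by rewrite wedge_coef_notin // conjC0 scale0r.
(* Writing [set0] as [[set i] :\ i] exposes the sign times its conjugate. *)
rewrite Dq_spin0 -scalerAr scalerA mulrC -[set0](setDv [set i]).
by rewrite wedge_coef_norm ?set11 ?scale1r.
Qed.

Lemma Bop_spinT (p : {mpoly C[m + m]}) :
  Bop q (spin setT p) setT = qeuler q (@rshift m m) p.
Proof.
(* Dually, no basis form produced by [iota_ i] contains [i], so [Dqdag (Zdag f)] has no component at
   [setT]. *)
rewrite ffunE DqdagE big1 ?add0r => [|i _]; last first.
  by rewrite big1 // => T _; rewrite wedge_coef_in ?inE ?conjC0 ?scale0r.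
rewrite ZdagE; apply: eq_bigr => i _.
rewrite (bigD1 (setT :\ i)) //= big1 ?addr0 => [|T Ti]; last first.
  by rewrite wedge_coef_neq ?scale0r.
rewrite Dqdag_spinT -scalerAr scalerA.
by rewrite wedge_coef_norm ?inE ?scale1r.
Qed.

(** * Quadratic test monomials and the failure of scalarity *)

Lemma spinX_component (r s : nat) S (a : 'X_{1..m + m}) :
  zdeg a = r -> wdeg a = s -> spin S 'X_[a] \in component r s #|S|.
Proof.
move=> ar as_; rewrite inE; apply/forallP => T; rewrite ffunE.
have [->|TS] := eqVneq T S; first by rewrite eqxx !dhomogX /= ar as_ !eqxx.
by case: ifP => // _; rewrite !rpred0.
Qed.

Lemma zdeg_zvar i : zdeg (U_(zvar i) : 'X_{1..m + m}) = 1%N.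
Proof.
rewrite /zdeg (bigD1 i) //= mnm1E eqxx big1 // => j ji.
by rewrite mnm1E (inj_eq (@lshift_inj _ _)) eq_sym (negbTE ji).
Qed.

Lemma wdeg_zvar i : wdeg (U_(zvar i) : 'X_{1..m + m}) = 0%N.
Proof. by rewrite /wdeg big1 // => j _; rewrite mnm1E eq_lrshift. Qed.

Lemma zdeg_wvar i : zdeg (U_(wvar i) : 'X_{1..m + m}) = 0%N.
Proof. by rewrite /zdeg big1 // => j _; rewrite mnm1E eq_rlshift. Qed.

Lemma wdeg_wvar i : wdeg (U_(wvar i) : 'X_{1..m + m}) = 1%N.
Proof.
rewrite /wdeg (bigD1 i) //= mnm1E eqxx big1 // => j ji.
by rewrite mnm1E (inj_eq (@rshift_inj _ _)) eq_sym (negbTE ji).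
Qed.

Hypotheses (m_gt1 : (1 < m)%N) (q_neq1 : q != 1).

Lemma Aop_not_scalar : ~ scalar_on (component 2 0 0) (Aop (m := m) q).
Proof.
pose i0 := Ordinal (ltnW m_gt1); pose i1 := Ordinal m_gt1.
case=> c Ac.
(* The same [c] serves the square ([i = j]) and the mixed monomial ([i != j]), which
   [qeuler_not_scalar] forbids. *)
have Ec (i j : 'I_m) : qeuler q (@lshift m m) 'X_[U_(zvar i) + U_(zvar j)]
    = c *: 'X_[U_(zvar i) + U_(zvar j)].
  rewrite -Aop_spin0 Ac; first by rewrite !ffunE eqxx.
  rewrite -[X in component _ _ X](cards0 'I_m).
  by apply: spinX_component; rewrite ?zdegD ?wdegD ?zdeg_zvar ?wdeg_zvar.
have /eqP[] := qeuler_not_scalar q_neq1 (@lshift_inj m m)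
  (isT : i0 != i1) (Ec i0 i0).
exact: Ec.
Qed.

Lemma Bop_not_scalar : ~ scalar_on (component 0 2 m) (Bop (m := m) q).
Proof.
pose i0 := Ordinal (ltnW m_gt1); pose i1 := Ordinal m_gt1.
case=> c Bc.
have Ec (i j : 'I_m) : qeuler q (@rshift m m) 'X_[U_(wvar i) + U_(wvar j)]
    = c *: 'X_[U_(wvar i) + U_(wvar j)].
  have cardT : #|[set: 'I_m]| = m by rewrite cardsT card_ord.
  rewrite -Bop_spinT Bc; first by rewrite !ffunE eqxx.
  rewrite -[X in component _ _ X]cardT.
  by apply: spinX_component; rewrite ?zdegD ?wdegD ?zdeg_wvar ?wdeg_wvar.
have /eqP[] := qeuler_not_scalar q_neq1 (@rshift_inj m m)
  (isT : i0 != i1) (Ec i0 i0).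
exact: Ec.
Qed.

End Extremes.

Unset Implicit Arguments.

Theorem proposition3p5 (R : realType) (m : nat) (q : R)
    (hm : (2 <= m)%N) (hq0 : 0 < q) (hq1 : q < 1) :
  (~ scalar_on (component 2 0 0) (Aop (m := m) q%:C)
   /\ ~ scalar_on (component 0 2 m) (Bop (m := m) q%:C))
  /\ (~ fun_of_zdeg_spinor (Aop (m := m) q%:C)
      /\ ~ fun_of_wdeg_spinor (Bop (m := m) q%:C)).
Proof.
have q1 : q%:C != 1.
  by apply: contraTneq hq1 => -[->]; rewrite Order.POrderTheory.ltxx.
have nA := Aop_not_scalar hm q1; have nB := Bop_not_scalar hm q1.
split; split=> //.
(* On a single component, [phi] takes one value, which would be the scalar already excluded. *)
- by case=> phi Aphi; apply: nA; exists (phi 2%N 0%N) => f; apply: Aphi.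
- by case=> phi Bphi; apply: nB; exists (phi 2%N m) => f; apply: Bphi.
Qed.
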